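(* For any odd $n\ge 3$ and any $r\in\{2,\dots,n-1\}$, $$n+r-2\ \le\ \ell_{\min}^{\mathrm{Tour}}(n,r)\ \le\ n+8r,$$ $$(\hat r+1)(n-\hat r)-1\ \le\ \ell_{\max}^{\mathrm{Tour}}(n,r)\ \le\ 6rn+n-10r,$$ where $\hat r=\min\{r-1,\lfloor n/2\rfloor\}$.
   Context: $[n]=\{1,\dots,n\}$. A tournament on $[n]$ is a digraph $T$ with vertex set $[n]$, without loops, such that for every pair of distinct $u,v$ exactly one of $(u,v),(v,u)$ is an edge; it is strong if for all $u,v$ there is a directed path from $u$ to $v$. $\mathrm{Tour}_n$ is the set of all strong tournaments on $[n]$. For distinct $a,b\in[n]$, $(a\to b)$ is the transformation of $[n]$ sending $a$ to $b$ and fixing every other point; maps act on the right and products are composed from left to right. For a digraph $D$ on $[n]$, $\langle D\rangle$ is the semigroup generated by $\{(a\to b):(a,b)\in E(D)\}$; for $n\ge3$ and $T\in\mathrm{Tour}_n$ it is known that $\langle T\rangle=\mathrm{Sing}_n$, the semigroup of all non-invertible transformations of $[n]$. For $\alpha\in\langle D\rangle$, $\ell(D,\alpha)$ is the minimum length of a word in the generators $(a\to b)$, $(a,b)\in E(D)$, whose product is $\alpha$, and $\ell(D,r)=\max\{\ell(D,\alpha):\alpha\in\langle D\rangle,\ \mathrm{rk}(\alpha)=r\}$, where $\mathrm{rk}(\alpha)$ is the size of the image of $\alpha$. Define $\ell_{\max}^{\mathrm{Tour}}(n,r)=\max\{\ell(T,r):T\in\mathrm{Tour}_n\}$ and $\ell_{\min}^{\mathrm{Tour}}(n,r)=\min\{\ell(T,r):T\in\mathrm{Tour}_n\}$.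 *)

(* Defs.v *)
From mathcomp Require Import all_boot.
From mathcomp Require Import boolp.

Set Implicit Arguments.
Unset Strict Implicit.
Unset Printing Implicit Defensive.

(* The least element of P; 0 is a junk value for empty P. *)
Definition nat_min (P : nat -> Prop) : nat :=
  match pselect (exists k, `[< P k >]) with
  | left exP => ex_minn exP
  | right _ => 0
  end.

Lemma nat_minP (P : nat -> Prop) :
  (exists k, P k) -> P (nat_min P) /\ (forall k, P k -> nat_min P <= k).
Proof.
move=> [k0 Pk0]; rewrite /nat_min; case: pselect => [exP|]; last first.
  by case; exists k0; apply/asboolP.
case: ex_minnP => m /asboolP Pm minm; split=> // k Pk.
by apply: minm; apply/asboolP.
Qed.

(* The vertex set {1, ..., n} is represented by 'I_n, and a digraph by its set
   of edges. *)
Definition digraph (n : nat) := {set 'I_n * 'I_n}.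

Definition tournament (n : nat) (T : digraph n) : bool :=
  [forall u, (u, u) \notin T] &&
  [forall u, forall v, (u != v) ==> (((u, v) \in T) (+) ((v, u) \in T))].

Definition strong (n : nat) (D : digraph n) : bool :=
  [forall u, forall v, connect [rel a b | (a, b) \in D] u v].

Definition Tour (n : nat) : {set digraph n} :=
  [set T | tournament T && strong T].

Definition transf (n : nat) := {ffun 'I_n -> 'I_n}.

Definition arc (n : nat) (e : 'I_n * 'I_n) : transf n :=
  [ffun x => if x == e.1 then e.2 else x].

(* Maps act on the right: in f * g, the factor f is applied first. *)
Definition transf_mul (n : nat) (f g : transf n) : transf n :=
  [ffun x => g (f x)].

Definition transf_id (n : nat) : transf n := [ffun x => x].

Definition word_prod (n : nat) (w : seq ('I_n * 'I_n)) : transf n :=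
  foldr (@transf_mul n) (transf_id n) (map (@arc n) w).

(* Words are nonempty, since <D> is a semigroup and not a monoid. *)
Definition expresses (n : nat) (D : digraph n) (w : seq ('I_n * 'I_n))
    (alpha : transf n) : Prop :=
  [/\ w != [::], {in w, forall e, e \in D} & word_prod w = alpha].

Definition in_gen (n : nat) (D : digraph n) (alpha : transf n) : Prop :=
  exists w, expresses D w alpha.

Definition ell (n : nat) (D : digraph n) (alpha : transf n) : nat :=
  nat_min (fun k => exists2 w, expresses D w alpha & size w = k).

Definition rk (n : nat) (alpha : transf n) : nat := #|codom alpha|.

Definition ell_rank (n : nat) (D : digraph n) (r : nat) : nat :=
  \max_(alpha : transf n | `[< in_gen D alpha >] && (rk alpha == r))
     ell D alpha.

Definition ell_max_Tour (n r : nat) : nat :=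
  \max_(T in Tour n) ell_rank T r.

Definition ell_min_Tour (n r : nat) : nat :=
  nat_min (fun k => exists2 T, T \in Tour n & ell_rank T r = k).

(* Main.v *)
Require Import Defs.
From mathcomp Require Import all_boot.
From mathcomp Require Import boolp zify.

Set Implicit Arguments.
Unset Strict Implicit.
Unset Printing Implicit Defensive.

(** Read a word as a sequence of moves of tokens: token x starts at vertex x,
    the arc (a, b) carries everything standing at a to b, and the product sends
    x to the final position of token x.  Tokens that meet stay together.

    Upper bounds.  Let alpha have rank r < n.  In a tournament any two vertices
    are joined by an arc, so two tokens with the same image can be merged by one
    arc; n - r arcs produce the kernel of alpha ([collapse_kernel]).  There
    remain r distinct tokens to be brought to r distinct targets, with at least
    one free vertex.  A geodesic q 0, ..., q d of a tournament has all the arcs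
    q (i + 2) -> q i, so consecutive triples are directed 3-cycles, on which two
    tokens can be exchanged with the help of a free vertex.  Hence one token can
    travel from q 0 to the free vertex q d within 4 d - 3 arcs, all others
    ending where they began ([geodesic_move]).  Such moves sort r tokens as in
    the complete digraph: one move per misplaced token, plus one extra move per
    cycle, so at most 3 r / 2 moves ([sortable_misplaced]).  If all distances
    are at most D the total is at most
      n - r + (3 r / 2) (4 D - 3) <= n - r + r (6 D - 3).
    D = n - 1 holds for every strong tournament, and D = 2 for a circulant one
    when n is odd ([parity_tournament]).

    Lower bounds.  Attach to some tokens sets of vertices which they have to
    leave.  If no step of a word can perform two of these departures at once,
    the word is at least as long as the number of departures
    ([departures_le_size]).
    - In any tournament, reverse r - 1 arcs of a Hamiltonian path and send all
      other vertices to one further point.  Each of the n tokens leaves its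
      origin, and each of the r - 1 tokens sent against an arc also needs a step
      that enters its target, which cannot be its departure from the origin nor
      that of another token ([ell_rank_ge_backward]).
    - In the tournament where ascending arcs have length one, translate the
      first s vertices by n - s and push the other n - s vertices down.  Each
      translated token passes n - s thresholds one at a time, and each other
      token leaves its origin: (s + 1) (n - s) departures ([ell_rank_path]). *)

(** * Words acting on vertices *)

Section Words.
Variable n : nat.
Implicit Types (T : digraph n) (w : seq ('I_n * 'I_n)) (x y : 'I_n).

Lemma arcE (e : 'I_n * 'I_n) x : Defs.arc e x = if x == e.1 then e.2 else x.
Proof. by rewrite ffunE. Qed.

Lemma word_prod_nil x : word_prod [::] x = x.
Proof. by rewrite /word_prod /= ffunE. Qed.

Lemma word_prod_cons e w x : word_prod (e :: w) x = word_prod w (Defs.arc e x).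
Proof. by rewrite /word_prod /= ffunE. Qed.

Lemma word_prod_cat w1 w2 x :
  word_prod (w1 ++ w2) x = word_prod w2 (word_prod w1 x).
Proof.
elim: w1 x => [|e w1 IH] x; first by rewrite word_prod_nil.
by rewrite cat_cons !word_prod_cons IH.
Qed.

Lemma tournament_arcV T x y :
  tournament T -> x != y -> ((y, x) \in T) = ((x, y) \notin T).
Proof.
case/andP=> _ /forallP/(_ x)/forallP/(_ y)/implyP H /H.
by case: (_ \in T); case: (_ \in T).
Qed.

Lemma tournament_neq T x y : tournament T -> (x, y) \in T -> x != y.
Proof.
case/andP=> /forallP H _ xy; apply: contraTneq xy => ->; exact: H.
Qed.

End Words.

(** * Moving one token along a geodesic *)

Section Moves.
Variables (n : nat) (T : digraph n).
Implicit Types (w : seq ('I_n * 'I_n)) (a b x y : 'I_n) (q : nat -> 'I_n).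

Definition walk q d a b : Prop :=
  [/\ q 0 = a, q d = b & forall i, i < d -> (q i, q i.+1) \in T].

Lemma walk_cut q d a b i j : walk q d a b -> i < j <= d -> q i = q j ->
  exists q', walk q' (d - (j - i)) a b.
Proof.
move=> [q0 qd qarc] ij qij.
exists (fun k => if k <= i then q k else q (k + (j - i))); split=> //.
- case: leqP => h; last by rewrite subnK //; lia.
  have -> : d - (j - i) = i by lia.
  by rewrite qij -qd; congr q; lia.
- move=> k; case: (ltngtP k i) => [ki|ki|->] kd.
  + by apply: qarc; lia.
  + by rewrite addSn; apply: qarc; lia.
  + rewrite qij addSn; have -> : i + (j - i) = j by lia.
    by apply: qarc; lia.
Qed.

Lemma walk_shortcut q d a b i : walk q d a b -> i.+1 < d ->
  (q i, q i.+2) \in T -> exists q', walk q' d.-1 a b.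
Proof.
move=> [q0 qd qarc] id qii.
exists (fun k => if k <= i then q k else q k.+1); split=> //.
- have -> : (d.-1 <= i) = false by lia.
  by rewrite prednK //; lia.
- move=> k; case: (ltngtP k i) => [ki|ki|->] kd //; by apply: qarc; lia.
Qed.

(** In a tournament a walk of minimal length is injective and cannot be
    shortened by an arc q i -> q (i + 2); that arc is therefore reversed. *)
Definition geodesic q d : Prop :=
  [/\ forall i j, i <= d -> j <= d -> q i = q j -> i = j,
      forall i, i < d -> (q i, q i.+1) \in T
    & forall i, i.+1 < d -> (q i.+2, q i) \in T].

Lemma exists_geodesic q0 d0 a b : tournament T -> walk q0 d0 a b ->
  exists q d, [/\ walk q d a b, geodesic q d, d <= d0 & d < n].
Proof.
move=> tourT W0.
have ex : exists d, `[< exists q, walk q d a b >].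
  by exists d0; apply/asboolP; exists q0.
case: (ex_minnP ex) => d /asboolP[q W] dmin.
have dminw d' q' : walk q' d' a b -> d <= d'.
  by move=> W'; apply: dmin; apply/asboolP; exists q'.
have qlt i j : i < j <= d -> q i <> q j.
  move=> ij /(walk_cut W ij) [q' /dminw]; lia.
have qinj i j : i <= d -> j <= d -> q i = q j -> i = j.
  move=> id jd qij; case: (ltngtP i j) => // h; exfalso.
  - by apply: (qlt i j) => //; lia.
  - by apply: (qlt j i) => //; lia.
have [_ _ qarc] := W.
exists q, d; split=> //; last 2 first.
- exact: dminw W0.
- have /leq_card : injective (fun i : 'I_d.+1 => q i).
    by move=> i j /qinj ij; apply: val_inj; apply: ij; rewrite -ltnS.
  by rewrite !card_ord.
split=> // i id; rewrite tournament_arcV //.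
- by apply/negP => /(walk_shortcut W id) [q' /dminw]; lia.
- by apply/eqP => /qinj; lia.
Qed.

(** Moves the contents of q 0, ..., q (m - 1) one vertex forward, the last
    one going first so that nothing merges unless q m is occupied. *)
Fixpoint shift_word q m :=
  if m is k.+1 then (q k, q k.+1) :: shift_word q k else [::].

Lemma size_shift_word q m : size (shift_word q m) = m.
Proof. by elim: m => //= m ->. Qed.

Lemma shift_word_out q m x : (forall i, i < m -> x <> q i) ->
  word_prod (shift_word q m) x = x.
Proof.
elim: m => [|m IH] xq; first by rewrite word_prod_nil.
rewrite word_prod_cons arcE /= ifN; last exact/eqP/xq.
by apply: IH => i im; apply: xq; lia.
Qed.

Lemma shift_word_in q m i :
    (forall i j, i <= m -> j <= m -> q i = q j -> i = j) -> i < m ->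
  word_prod (shift_word q m) (q i) = q i.+1.
Proof.
elim: m => // m IH qinj im.
rewrite word_prod_cons arcE /=.
case: eqP => [/qinj E|ne].
  have -> : i = m by apply: E; lia.
  by apply: shift_word_out => j jm /qinj; lia.
apply: IH => [j k jm km|]; first by apply: qinj; lia.
by case: (ltngtP i m) ne => [||->] //; lia.
Qed.

(** With q 0 free, the two arcs of stage k carry the token of q (k + 2) back to
    q k and the token travelling from q 1 on to q (k + 2), through the vertex
    just freed.  So this token overtakes m others, each of which steps back by
    two. *)
Fixpoint bubble_word q m :=
  if m is k.+1
  then bubble_word q k ++ [:: (q k.+2, q k); (q k.+1, q k.+2)] else [::].

Lemma size_bubble_word q m : size (bubble_word q m) = 2 * m.
Proof. by elim: m => // m IH; rewrite /= size_cat IH /=; lia. Qed.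

Lemma bubble_word_out q m x : (forall i, i <= m.+1 -> x <> q i) ->
  word_prod (bubble_word q m) x = x.
Proof.
elim: m => [|m IH] xq; first by rewrite word_prod_nil.
rewrite word_prod_cat IH => [|i im]; last by apply: xq; lia.
have ne i : i <= m.+2 -> (x == q i) = false by move=> im; apply/eqP/xq.
by rewrite !word_prod_cons word_prod_nil !arcE /= !ne.
Qed.

Lemma bubble_word1 q m :
    (forall i j, i <= m.+1 -> j <= m.+1 -> q i = q j -> i = j) ->
  word_prod (bubble_word q m) (q 1) = q m.+1.
Proof.
elim: m => [|m IH] qinj; first by rewrite word_prod_nil.
rewrite word_prod_cat IH => [|i j im jm]; last by apply: qinj; lia.
have ne i j : i <= m.+2 -> j <= m.+2 -> i != j -> (q i == q j) = false.
  by move=> im jm; apply: contraNF => /eqP/qinj ->.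
by rewrite !word_prod_cons word_prod_nil !arcE /= ne ?eqxx //; lia.
Qed.

Lemma bubble_word_in q m i :
    (forall i j, i <= m.+1 -> j <= m.+1 -> q i = q j -> i = j) -> i < m ->
  word_prod (bubble_word q m) (q i.+2) = q i.
Proof.
elim: m => // m IH qinj im.
have ne k j : k <= m.+2 -> j <= m.+2 -> k != j -> (q k == q j) = false.
  by move=> km jm; apply: contraNF => /eqP/qinj ->.
rewrite word_prod_cat !word_prod_cons word_prod_nil !arcE /=.
case: (ltngtP i m) im => [lt|gt|->] im; [|lia|].
  by rewrite IH // => [|j k jm km]; [rewrite !ne //; lia|apply: qinj; lia].
rewrite bubble_word_out => [|j jm /qinj]; last by lia.
by rewrite eqxx ne //; lia.
Qed.

(** All tokens advance by one; the token of q 0, now at q 1, overtakes the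
    others, which step back by two; and these advance by one again. The
    value at q d is left open: a token standing there would be merged with its
    predecessor on the path. *)
Lemma geodesic_move q d : geodesic q d -> 0 < d ->
  exists w, [/\ {in w, forall e, e \in T}, size w <= 4 * d - 3
    & forall x, x != q d -> word_prod w x = if x == q 0 then q d else x].
Proof.
move=> [qinj qarc qback] d0.
have shiftT m : m <= d -> {in shift_word q m, forall e, e \in T}.
  elim: m => // m IH md e; rewrite inE => /orP[/eqP->|/IH->//].
    by apply: qarc; lia.
  by lia.
have bubbleT m : m < d -> {in bubble_word q m, forall e, e \in T}.
  elim: m => // m IH md e; rewrite mem_cat => /orP[/IH->//|]; first by lia.
  rewrite !inE => /orP[]/eqP->; [apply: qback|apply: qarc]; lia.
exists (shift_word q d ++ bubble_word q d.-1 ++ shift_word q d.-1); split.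
- move=> e; rewrite !mem_cat => /or3P[].
  + by apply: shiftT.
  + by apply: bubbleT; lia.
  + by apply: shiftT; lia.
- by rewrite !size_cat !size_shift_word size_bubble_word; lia.
have d1 : d.-1.+1 = d by lia.
move=> x xd; rewrite !word_prod_cat.
have [/'exists_eqP[i ->]|nx] := boolP [exists i : 'I_d, x == q i]; last first.
  have out j : j < d -> x <> q j.
    move=> jd xj; case/existsP: nx; exists (Ordinal jd); exact/eqP.
  rewrite (shift_word_out out) bubble_word_out; last first.
    move=> j jd xj; case: (ltngtP j d) => h; [exact: out xj|lia|].
    by rewrite xj h eqxx in xd.
  rewrite shift_word_out => [|j jd]; last by apply: out; lia.
  by rewrite ifN //; apply/eqP/out.
case: i => -[|i] id /=.
  rewrite (shift_word_in qinj id) bubble_word1 d1 // eqxx.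
  by apply: shift_word_out => j jd /qinj; lia.
rewrite (shift_word_in qinj id) bubble_word_in ?d1 //; last by lia.
rewrite shift_word_in; last by lia.
  by rewrite ifN //; apply/eqP => /qinj; lia.
by move=> j k jd kd; apply: qinj; lia.
Qed.

End Moves.

(** * Factorizing a transformation into arcs *)

Section Sorting.
Variables (n : nat) (T : digraph n).
Hypothesis tourT : tournament T.
Implicit Types (w : seq ('I_n * 'I_n)) (a b x y : 'I_n) (alpha : transf n).

Definition distances_le D : Prop :=
  forall a b, a != b -> exists q d, walk T q d a b /\ d <= D.

Definition refines (I : Type) (f g : I -> 'I_n) : Prop :=
  forall i j, f i = f j -> g i = g j.

Lemma rk_refines (f g : transf n) : refines f g -> rk g <= rk f.
Proof.
move=> fg; pose h b := if [pick x | f x == b] is Some x then g x else b.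
have hE x : h (f x) = g x.
  by rewrite /h; case: pickP => [y /eqP/fg//|/(_ x)]; rewrite eqxx.
rewrite /rk; apply: leq_trans (leq_image_card h (mem (codom f))).
apply/subset_leq_card/subsetP => _ /codomP[x ->].
by rewrite -hE; apply/image_f/codom_f.
Qed.

Lemma rk_rcons w a b : a != b ->
    a \in codom (word_prod w) -> b \in codom (word_prod w) ->
  rk (word_prod (rcons w (a, b))) < rk (word_prod w).
Proof.
move=> ab aw bw; rewrite /rk [X in _ < X](cardD1 a) aw add1n ltnS.
apply/subset_leq_card/subsetP => _ /codomP[x ->].
rewrite -cats1 word_prod_cat word_prod_cons word_prod_nil arcE inE /=.
have [_|ne] := eqVneq (word_prod w x) a; first by rewrite [b == a]eq_sym ab.
by rewrite ne codom_f.
Qed.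

(** As long as the current kernel is strictly finer than that of alpha, some two
    occupied vertices hold tokens with the same image under alpha, and the arc
    joining them lowers the rank by one.  This must stop within n - rk alpha
    steps, since a map with a finer kernel cannot have a smaller rank. *)
Lemma collapse_kernel alpha : exists w,
  [/\ {in w, forall e, e \in T}, size w <= n - rk alpha,
      refines (word_prod w) alpha & refines alpha (word_prod w)].
Proof.
have step k :
    (exists w, [/\ {in w, forall e, e \in T}, size w < k,
      refines (word_prod w) alpha & refines alpha (word_prod w)])
    \/ (exists w, [/\ {in w, forall e, e \in T}, size w = k,
      rk (word_prod w) + k <= n & refines (word_prod w) alpha]).
  elim: k => [|k [[w [wT wk w1 w2]]|[w [wT wk rkw w1]]]].
  - right; exists [::]; split=> //.
      by rewrite addn0 -[X in _ <= X]card_ord max_card.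
    by move=> x y; rewrite !word_prod_nil => ->.
  - by left; exists w; split=> //; apply: leqW.
  have [/'forall_forallP fine|] :=
    boolP [forall x, forall y,
      (alpha x == alpha y) ==> (word_prod w x == word_prod w y)].
    left; exists w; split; rewrite ?wk // => x y /eqP xy.
    by apply/eqP; apply: implyP xy; apply: fine.
  rewrite negb_forall => /existsP[x]; rewrite negb_forall => /existsP[y].
  rewrite negb_imply => /andP[/eqP xy wxy]; right.
  (* The roles of x and y are symmetric, so the arc may be taken to go from x
     to y. *)
  wlog arcT : x y xy wxy / (word_prod w x, word_prod w y) \in T.
    move=> H; have [|yx] := boolP ((word_prod w x, word_prod w y) \in T).
      exact: H.
    by apply: (H y x); rewrite // 1?eq_sym // tournament_arcV.
  exists (rcons w (word_prod w x, word_prod w y)); split.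
  - by move=> e; rewrite mem_rcons inE => /orP[/eqP->|/wT].
  - by rewrite size_rcons wk.
  - have := rk_rcons wxy (codom_f _ x) (codom_f _ y); lia.
  - move=> u v; rewrite -cats1 !word_prod_cat !word_prod_cons !word_prod_nil.
    rewrite !arcE /=; have [/w1 ->|_] := eqVneq.
      by have [/w1 ->|_ /w1 <-] := eqVneq.
    by have [/w1 -> /w1|_ /w1] := eqVneq; rewrite -?xy.
case: (step (n - rk alpha).+1) => [[w [wT wk w1 w2]]|]; first by exists w.
by case=> w [_ _ rkw /rk_refines]; lia.
Qed.

Variable D : nat.
Hypothesis distD : distances_le D.

Lemma single_move a b : a != b -> exists w,
  [/\ {in w, forall e, e \in T}, size w <= 4 * D - 3
    & forall x, x != b -> word_prod w x = if x == a then b else x].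
Proof.
move=> ab; have [q0 [d0 [W0 d0D]]] := distD ab.
have [q [d [[q0a qdb _] geo dd0 _]]] := exists_geodesic tourT W0.
have d_gt0 : 0 < d.
  by rewrite lt0n; apply: contraNneq ab => d_eq0; rewrite -q0a -qdb d_eq0.
have [w [wT sw wE]] := geodesic_move geo d_gt0.
exists w; rewrite -q0a -qdb; split=> //; lia.
Qed.

Section Tokens.
Variable K : finType.
Implicit Types (p t : K -> 'I_n) (i k : K) (m : nat).

Definition place p i b : K -> 'I_n := fun k => if k == i then b else p k.

Lemma place_inj p i b : injective p -> (forall k, p k != b) ->
  injective (place p i b).
Proof.
move=> pinj free k l; rewrite /place.
have [->|ki] := eqVneq k i; have [->|li] := eqVneq l i => //.
- by move=> E; case/eqP: (free l).
- by move=> E; case/eqP: (free k).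
- exact: pinj.
Qed.

(** The length is doubled because the budget is three halves of a move per
    misplaced token. *)
Definition sortable p t s : Prop := exists w,
  [/\ {in w, forall e, e \in T}, 2 * size w <= s
    & forall k, word_prod w (p k) = t k].

Lemma sortable_place p t i b s : injective p -> (forall k, p k != b) ->
  sortable (place p i b) t s -> sortable p t (2 * (4 * D - 3) + s).
Proof.
move=> pinj free [w [wT sw wE]].
have [v [vT sv vE]] := single_move (free i).
exists (v ++ w); split.
- by move=> e; rewrite mem_cat => /orP[/vT|/wT].
- by rewrite size_cat; lia.
move=> k; rewrite word_prod_cat vE // -wE /place.
by rewrite (inj_eq pinj).
Qed.

Definition misplaced p t := [set k | p k != t k].

Lemma sortable_le p t s s' : s <= s' -> sortable p t s -> sortable p t s'.
Proof.
by move=> ss [w [wT sw wE]]; exists w; split=> //; apply: leq_trans ss.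
Qed.

(** A token whose target is free is moved there.  If no misplaced token has a
    free target, then the misplaced tokens permute their targets; parking a
    token i of a cycle at a free vertex frees the target of its predecessor j,
    whose move frees the target of its own predecessor k (possibly k = i).  So
    three moves settle the two tokens j and k, and in both cases the cost is at
    most three halves of a move per settled token. *)
Lemma sortable_misplaced p t : injective p -> injective t -> #|K| < n ->
  sortable p t (3 * #|misplaced p t| * (4 * D - 3)).
Proof.
move=> + tinj Kn; move Dm: #|misplaced p t| => m.
elim/ltn_ind: m p Dm => m IH p Dm pinj.
have solve p' m' : injective p' -> #|misplaced p' t| <= m' -> m' < m ->
    sortable p' t (3 * m' * (4 * D - 3)).
  move=> p'inj p'm' m'm.
  apply: sortable_le (IH _ (leq_ltn_trans p'm' m'm) p' erefl p'inj).
  by rewrite leq_mul2r leq_mul2l p'm' !orbT.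
have [M0|[i iM]] := set_0Vmem (misplaced p t).
  exists [::]; split=> // k; rewrite word_prod_nil; apply/eqP.
  by have := in_set0 k; rewrite -M0 inE => /negbFE.
have [/exists_inP[j jM tj]|/exists_inPn occ] :=
    boolP [exists j in misplaced p t, t j \notin codom p].
  have free k : p k != t j by apply: contraNneq tj => <-; apply: codom_f.
  have M'M : #|misplaced (place p j (t j)) t| <= m.-1.
    rewrite -Dm (cardsD1 j (misplaced p t)) jM.
    apply/subset_leq_card/subsetP => k.
    by rewrite !inE /place; case: (eqVneq k j) => [->|]; rewrite ?eqxx.
  have m0 : 0 < m by rewrite -Dm; apply/card_gt0P; exists j.
  apply: sortable_le (sortable_place pinj free (solve _ m.-1 _ M'M _)).
  - by move: (4 * D - 3) => c; nia.
  - exact: place_inj.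
  - by lia.
(* The targets of misplaced tokens are all occupied, necessarily by misplaced
   tokens; by counting, every vertex holding a misplaced token is a target. *)
have occupier k : k \in misplaced p t -> exists2 l, t l = p k & l != k.
  move=> kM.
  have eqM : t @: misplaced p t = p @: misplaced p t.
    apply/eqP; rewrite eqEcard !card_imset // leqnn andbT.
    apply/subsetP => _ /imsetP[l lM ->].
    have /negPn/codomP[l' tl] := occ l lM; rewrite tl imset_f // inE.
    apply: contraTneq lM => pl'; rewrite inE negbK.
    have ll' : l = l' by apply: tinj; rewrite tl.
    by rewrite {1}ll' pl' ll'.
  have : p k \in p @: misplaced p t by apply: imset_f.
  rewrite -eqM => /imsetP[l lM pk]; exists l => //.
  apply: contraTneq kM => lk; rewrite inE negbK.
  by rewrite pk lk.
have [j tj ji] := occupier i iM.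
have jM : j \in misplaced p t.
  by rewrite inE tj (inj_eq pinj).
have [k tk kj] := occupier j jM.
have kM : k \in misplaced p t.
  by rewrite inE tk (inj_eq pinj).
have [h hp] : exists h, forall l, p l != h.
  have [h /negP hp|allp] := pickP [pred h | h \notin codom p].
    by exists h => l; apply/eqP => E; apply: hp; rewrite -E codom_f.
  suff : n <= #|K| by rewrite leqNgt Kn.
  rewrite -(card_codom pinj) -[X in X <= _]card_ord.
  by apply/subset_leq_card/subsetP => x _; apply/negbFE/allp.
pose p1 := place p i h; pose p2 := place p1 j (t j); pose p3 := place p2 k (t k).
have p1inj : injective p1 by apply: place_inj.
have free1 l : p1 l != t j.
  rewrite tj /p1 /place; case: (eqVneq l i) => [_|li]; first by rewrite eq_sym.
  by rewrite (inj_eq pinj).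
have p2inj : injective p2 by apply: place_inj.
have free2 l : p2 l != t k.
  rewrite /p2 /place; case: (eqVneq l j) => [_|lj].
    by rewrite (inj_eq tinj) eq_sym.
  rewrite tk /p1 /place; case: (eqVneq l i) => [_|li]; first by rewrite eq_sym.
  by rewrite (inj_eq pinj).
have p3inj : injective p3 by apply: place_inj.
have M3M : #|misplaced p3 t| <= m - 2.
  have -> : m - 2 = #|(misplaced p t :\ j) :\ k|.
    have := cardsD1 j (misplaced p t); have := cardsD1 k (misplaced p t :\ j).
    by rewrite jM 2!inE kj kM Dm; lia.
  apply/subset_leq_card/subsetP => l; rewrite !inE /p3 /p2 /p1 /place.
  case: (eqVneq l k) => [->|lk]; first by rewrite eqxx.
  case: (eqVneq l j) => [->|lj]; first by rewrite eqxx.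
  by case: (eqVneq l i) => [->|li //]; move: iM; rewrite inE.
have m2 : 1 < m.
  rewrite -Dm (cardsD1 j) jM (cardsD1 k (_ :\ j)) 2!inE kj kM; lia.
apply: sortable_le (sortable_place pinj hp (sortable_place p1inj free1
  (sortable_place p2inj free2 (solve p3 (m - 2) p3inj M3M _)))); last by lia.
by move: (4 * D - 3) => c; nia.
Qed.

End Tokens.

(** The tokens of the second phase are the kernel classes, indexed by the image
    points of alpha. *)
Lemma expresses_bound alpha : 0 < D -> rk alpha < n -> exists2 w,
  expresses T w alpha & size w <= n - rk alpha + rk alpha * (6 * D - 3).
Proof.
move=> D0 rkn.
have [w [wT sw w1 w2]] := collapse_kernel alpha.
pose K : finType := {v | v \in codom alpha}.
pose p (v : K) := word_prod w (iinv (valP v)).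
have cardK : #|K| = rk alpha.
  by rewrite card_sig; apply: eq_card => x; rewrite !inE.
have pinj : injective p.
  by move=> u v /w1; rewrite !f_iinv => /val_inj.
have [|v [vT sv vE]] := sortable_misplaced pinj val_inj; first by rewrite cardK.
have prodE : word_prod (w ++ v) = alpha.
  apply/ffunP => x; rewrite word_prod_cat.
  have := vE (Sub (alpha x) (codom_f alpha x)); rewrite SubK => E.
  rewrite -[RHS]E /p; congr (word_prod v _).
  by apply: w2; rewrite f_iinv SubK.
exists (w ++ v).
  split=> //; last by move=> e; rewrite mem_cat => /orP[/wT|/vT].
  apply: contraTneq rkn => nil; rewrite -leqNgt -prodE nil /rk.
  by rewrite card_codom ?card_ord // => x y; rewrite !word_prod_nil.
have mK : #|misplaced p val| <= rk alpha by rewrite -cardK max_card.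
rewrite size_cat; apply: leq_add => //; rewrite -(leq_pmul2l (isT : 0 < 2)).
apply: leq_trans sv _.
apply: (@leq_trans (3 * rk alpha * (4 * D - 3))).
  by rewrite leq_mul2r leq_mul2l mK !orbT.
have [c Dc] : exists c, D = c.+1 by exists D.-1; lia.
by rewrite Dc; nia.
Qed.

End Sorting.

(** * Distances and strong connectedness *)

Lemma walk_connect n (T : digraph n) q d a b :
  walk T q d a b -> connect [rel u v | (u, v) \in T] a b.
Proof.
move=> [<- <-]; elim: d => [|d IH] qarc; first exact: connect0.
apply: connect_trans (connect1 _); last exact: qarc.
by apply: IH => i id; apply/qarc/ltnW.
Qed.

Lemma distances_le_strong n (T : digraph n) D : distances_le T D -> strong T.
Proof.
move=> distD; apply/'forall_forallP => a b.
have [->|/distD[q [d [/walk_connect //]]]] := eqVneq a b; exact: connect0.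
Qed.

Lemma strong_distances_le n (T : digraph n) :
  tournament T -> strong T -> distances_le T n.-1.
Proof.
move=> tourT /'forall_forallP strT a b _.
have /connectP[p /pathP ep bp] := strT a b.
have [|q [d [W _ _ dn]]] :=
    @exists_geodesic _ T (fun i => nth a (a :: p) i) (size p) a b tourT.
  split=> // [|i ip]; first by rewrite -last_nth.
  exact: ep.
by exists q, d; split=> //; lia.
Qed.

(** * Counting departures *)

Section LowerBound.
Variable n : nat.
Implicit Types (T : digraph n) (w : seq ('I_n * 'I_n)) (alpha : transf n).

Lemma departure w e0 x (P : pred 'I_n) : P x -> ~~ P (word_prod w x) ->
  exists k, [/\ k < size w, word_prod (take k w) x = (nth e0 w k).1,
                P (nth e0 w k).1 & ~~ P (nth e0 w k).2].
Proof.
elim: w x => [|e w IH] x Px; first by rewrite word_prod_nil Px.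
rewrite word_prod_cons => nPw; have [Pe|] := boolP (P (Defs.arc e x)).
  have [k [kw tk P1 P2]] := IH _ Pe nPw.
  by exists k.+1; split=> //=; rewrite word_prod_cons.
rewrite arcE; have [xe nPe|_] := eqVneq x e.1; last by rewrite Px.
by exists 0; split; rewrite //= ?word_prod_nil -?xe.
Qed.

(** Token x e stands in P e at the start and outside at the end, so some step
    carries it out of P e.  Two departures performed by the same step involve
    tokens standing together at that time, hence having the same image; the
    separation hypothesis then makes them equal. *)
Lemma departures_le_size T w alpha (E : finType) (x : E -> 'I_n)
    (P : E -> pred 'I_n) :
  expresses T w alpha ->
  (forall e, P e (x e)) -> (forall e, ~~ P e (alpha (x e))) ->
  (forall e e' a b, (a, b) \in T -> P e a -> ~~ P e b -> P e' a -> ~~ P e' b ->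
     alpha (x e) = alpha (x e') -> e = e') ->
  #|E| <= size w.
Proof.
case: w => [[]//|e0 w'] [_]; set w := e0 :: w' => wT wE Px nPx sep.
have dep e : exists k : 'I_(size w),
    [/\ word_prod (take k w) (x e) = (nth e0 w k).1,
        P e (nth e0 w k).1 & ~~ P e (nth e0 w k).2].
  have [|k [kw tk P1 P2]] := @departure w e0 (x e) (P e) (Px e).
    by rewrite wE.
  by exists (Ordinal kw).
have [f fE] := fin_all_exists dep.
rewrite -[size w]card_ord; apply: (@leq_card _ _ f) => e e' fee'.
have [t1 P1 Q1] := fE e; have [t2 P2 Q2] := fE e'.
rewrite -fee' in t2 P2 Q2.
apply: (sep e e' (nth e0 w (f e)).1 (nth e0 w (f e)).2) => //.
  by rewrite -surjective_pairing; apply/wT/mem_nth.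
by rewrite -wE -(cat_take_drop (f e) w) !word_prod_cat t1 t2.
Qed.

Lemma ell_le T w alpha : expresses T w alpha -> ell T alpha <= size w.
Proof.
move=> we; rewrite /ell; set Q := fun k => _.
have /nat_minP[_] : exists k, Q k by exists (size w), w.
by apply; exists w.
Qed.

Lemma ell_ge T alpha N : in_gen T alpha ->
  (forall w, expresses T w alpha -> N <= size w) -> N <= ell T alpha.
Proof.
move=> [w0 w0e] wN; rewrite /ell; set Q := fun k => _.
have /nat_minP[[w we <-] _] : exists k, Q k by exists (size w0), w0.
exact: wN.
Qed.

Lemma ell_rank_le T D r : tournament T -> distances_le T D -> 0 < D -> r < n ->
  ell_rank T r <= n - r + r * (6 * D - 3).
Proof.
move=> tourT distD D0 rn; apply/bigmax_leqP => alpha /andP[_ /eqP rka].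
have [|w we] := @expresses_bound _ _ tourT _ distD alpha D0.
  by rewrite rka.
by rewrite rka; apply: leq_trans; apply: ell_le.
Qed.

(** Every alpha of rank less than n is a product of arcs of T, by the
    upper bound; so a lower bound for its words bounds a genuine minimum, not a
    default value. *)
Lemma ell_rank_ge T alpha N : T \in Tour n -> rk alpha < n ->
  (forall w, expresses T w alpha -> N <= size w) -> N <= ell_rank T (rk alpha).
Proof.
rewrite inE => /andP[tourT strT] rkn wN.
have [n1|n2] := leqP n 1.
  have /card_gt0P[x _] : 0 < #|'I_n| by rewrite card_ord; lia.
  have : 0 < rk alpha by apply/card_gt0P; exists (alpha x); apply: codom_f.
  lia.
have [|w we _] := expresses_bound tourT (strong_distances_le tourT strT) _ rkn.
  by lia.
have gen : in_gen T alpha by exists w.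
apply: leq_trans (ell_ge gen wN) _.
by apply: leq_bigmax_cond; rewrite eqxx andbT; apply/asboolP.
Qed.

Lemma rk_eq r alpha (g : 'I_r -> 'I_n) : injective g ->
  (forall i, exists x, alpha x = g i) -> (forall x, exists i, alpha x = g i) ->
  rk alpha = r.
Proof.
move=> ginj ag ga; rewrite -[r]card_ord -(card_codom ginj); apply: eq_card => y.
apply/codomP/codomP => [[x ->]|[i ->]].
  by have [i] := ga x; exists i.
by have [x] := ag i; exists x.
Qed.

(** Sorting a list with respect to a total relation makes consecutive entries
    related, even when the relation is not transitive. *)
Lemma hamiltonian_path T : tournament T -> exists v : 'I_n -> 'I_n,
  bijective v /\ forall i j : 'I_n, j = i.+1 :> nat -> (v i, v j) \in T.
Proof.
move=> tourT; have [n0|n0] := posnP n.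
  exists id; split; first by exists id.
  by move=> i; have := ltn_ord i; lia.
pose x0 := Ordinal n0.
pose e : rel 'I_n := [rel a b | ((a, b) \in T) || (a == b)].
have etot : total e.
  move=> a b; rewrite /e /=; have [->|ab] := eqVneq a b; first by rewrite orbT.
  by rewrite !orbF (tournament_arcV tourT ab) orbN.
pose s := sort e (enum 'I_n).
have ss : size s = n by rewrite size_sort size_enum_ord.
have us : uniq s by rewrite sort_uniq enum_uniq.
exists (fun i => nth x0 s i); split.
  apply: injF_bij => i j /eqP; rewrite nth_uniq ?ss //; exact: val_eqP.
move=> i j ij; have sn : i.+1 < size s by rewrite ss -ij.
have := sort_sorted etot (enum 'I_n).
move/(sortedP x0)/(_ i sn) => /orP; rewrite ij => -[//|].
by rewrite nth_uniq ?ss //; lia.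
Qed.

End LowerBound.

(** Along a Hamiltonian path v, alpha sends v j to v (j - 1) for 0 < j < r and
    everything else to v (r - 1).  The departures are those of each token i from
    i, and those of v (j + 1), for j < r - 1, from the complement of its target
    v j.  No other token has the image v j, so a step performing two departures
    would use the arc from v (j + 1) to v j, opposite to an arc of T. *)
Lemma ell_rank_ge_backward n (T : digraph n) r :
  T \in Tour n -> 1 < r < n -> n + r - 1 <= ell_rank T r.
Proof.
case: n T => [|n] T TT rn; first by lia.
have := TT; rewrite inE => /andP[tourT _].
have [v [[u uv vu] varc]] := hamiltonian_path tourT.
pose phi (i : 'I_n.+1) : 'I_n.+1 := inord (if 0 < i < r then i.-1 else r.-1).
have phiE i : phi i = (if 0 < i < r then i.-1 else r.-1) :> nat.
  by rewrite inordK //; have := ltn_ord i; case: ifP; lia.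
pose alpha : transf n.+1 := [ffun x => v (phi (u x))].
have alphaE i : alpha (v i) = v (phi i) by rewrite ffunE uv.
have vinj : injective v := can_inj uv.
have rka : rk alpha = r.
  apply: (@rk_eq _ _ _ (fun j : 'I_r => v (inord j))) => [j k /vinj E|j|x].
  - apply: val_inj; move/(congr1 val): E; rewrite /= !inordK //.
    + by have := ltn_ord k; lia.
    + by have := ltn_ord j; lia.
  - exists (v (inord (if j.+1 < r then j.+1 else 0))).
    rewrite alphaE; congr v; apply: val_inj; rewrite /= phiE.
    have jr := ltn_ord j.
    by case: (ltnP j.+1 r) => jr1; rewrite !inordK /= ?jr1 //; lia.
  - have lt : phi (u x) < r by rewrite phiE; case: ifP; lia.
    by exists (Ordinal lt); rewrite ffunE /= inord_val.
rewrite -{2}rka; apply: ell_rank_ge => //; first by rewrite rka; lia.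
move=> w we.
pose x (e : 'I_n.+1 + 'I_(r.-1)) : 'I_n.+1 :=
  match e with inl i => i | inr j => v (inord j.+1) end.
pose P (e : 'I_n.+1 + 'I_(r.-1)) : pred 'I_n.+1 :=
  match e with inl i => pred1 i | inr j => predC1 (v (inord j)) end.
have jn (j : 'I_r.-1) : j.+1 < n.+1 by have := ltn_ord j; lia.
have alphaR (j : 'I_r.-1) : alpha (v (inord j.+1)) = v (inord j).
  rewrite alphaE; congr v; apply: val_inj.
  rewrite /= phiE !inordK ?(ltnW (jn j)) //.
  by have := ltn_ord j; case: ifP; lia.
have mixed i (j : 'I_r.-1) a b : (a, b) \in T -> P (inl i) a ->
    ~~ P (inr j) b -> alpha i = alpha (v (inord j.+1)) -> False.
  move=> + /eqP ai /negPn/eqP bj; rewrite alphaR => ab /eqP.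
  rewrite ffunE (inj_eq vinj) => /eqP/(congr1 val); rewrite /= phiE.
  rewrite inordK ?(ltnW (jn j)) // => uij.
  have ui : i = v (inord j.+1).
    rewrite -[i]vu; congr v; apply: val_inj; rewrite /= inordK //.
    by move: uij; have := ltn_ord j; case: ifP; lia.
  have arcj : (v (inord j), v (inord j.+1)) \in T.
    by apply: varc; rewrite !inordK ?(ltnW (jn j)).
  have := tournament_arcV tourT (tournament_neq tourT arcj).
  by rewrite arcj -bj -ui -ai ab.
suff : #|{: 'I_n.+1 + 'I_(r.-1)}| <= size w.
  by rewrite card_sum !card_ord; lia.
apply: (departures_le_size (x := x) (P := P) we).
- case=> [i|j] /=; first exact: eqxx.
  rewrite (inj_eq vinj); apply/eqP => /(congr1 val) /=.
  by rewrite !inordK ?(ltnW (jn j)) //; lia.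
- case=> [i|j] /=; last by rewrite alphaR eqxx.
  rewrite -[X in _ != X]vu ffunE (inj_eq vinj); apply/eqP => /(congr1 val).
  by rewrite /= phiE; case: ifP; lia.
- case=> [i|j] [i'|j'] a b ab.
  + by move=> /eqP <- _ /eqP <-.
  + by move=> Pa _ _ Pb' E; case: (mixed i j' a b).
  + by move=> _ Pb Pa' _ E; case: (mixed i' j a b).
  + move=> _ _ _ _ /=; rewrite !alphaR => /vinj/(congr1 val).
    rewrite /= !inordK ?(ltnW (jn _)) // => jj; congr inr; exact: val_inj.
Qed.

(** * Two extremal tournaments *)

(** Ascending arcs have length one, so tokens climb slowly; all longer arcs
    descend. *)
Definition path_tournament n : digraph n :=
  [set e : 'I_n * 'I_n | (e.2 == e.1.+1 :> nat) || (e.2.+1 < e.1)].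

Lemma path_tournamentE n (a b : 'I_n) :
  ((a, b) \in path_tournament n) = (b == a.+1 :> nat) || (b.+1 < a).
Proof. by rewrite inE. Qed.

Lemma path_tournament_Tour n : 2 < n -> path_tournament n \in Tour n.
Proof.
move=> n2; rewrite inE; apply/andP; split; first (apply/andP; split).
- by apply/forallP => u; rewrite path_tournamentE; lia.
- apply/'forall_forallP => u v; apply/implyP; rewrite !path_tournamentE.
  by rewrite -(inj_eq val_inj) /=; lia.
apply/'forall_forallP.
pose e := [rel a b : 'I_n | (a, b) \in path_tournament n].
have up (a b : 'I_n) : a <= b -> connect e a b.
  case: b => b bn /=; elim: b bn => [|b IH] bn ab.
    have -> : a = Ordinal bn by apply: val_inj => /=; lia.
    exact: connect0.
  have [ab'|ba] := leqP a b.
    apply: connect_trans (IH (ltnW bn) ab') (connect1 _).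
    by rewrite /e /= path_tournamentE eqxx.
  have -> : a = Ordinal bn by apply: val_inj => /=; lia.
  exact: connect0.
move=> a b.
have n0 : 0 < n by lia.
have n1 : n.-1 < n by lia.
apply: (@connect_trans _ _ (Ordinal n1)).
  by apply: up; have := ltn_ord a; rewrite /=; lia.
apply: (@connect_trans _ _ (Ordinal n0)); last by apply: up.
by apply: connect1; rewrite /e /= path_tournamentE /=; lia.
Qed.

Lemma path_tournament_cross n (a b : 'I_n) c :
  (a, b) \in path_tournament n -> a <= c -> c < b -> a = c :> nat.
Proof. by rewrite path_tournamentE; lia. Qed.

(** The first s tokens climb by n - s and have private images; a departure is
    recorded for each threshold passed on the way and for each other token
    leaving its origin.  The other tokens go to the r - s lowest vertices and all
    move, since s > 0; r - s <= n - s keeps their images away from those of the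
    climbing tokens. *)
Lemma ell_rank_path n r s : 2 < n -> 0 < s < r -> r < n ->
  (s + 1) * (n - s) <= ell_rank (path_tournament n) r.
Proof.
case: n => [//|n] n2 sr rn.
pose f x := if x < s then x + (n.+1 - s) else minn (x - s) (r - s - 1).
have fn x : x < n.+1 -> f x < n.+1 by rewrite /f; case: ifP; lia.
pose alpha : transf n.+1 := [ffun x : 'I_n.+1 => inord (f x)].
have alphaE (x : 'I_n.+1) : alpha x = f x :> nat.
  by rewrite ffunE inordK // fn.
pose g (i : 'I_r) : 'I_n.+1 :=
  inord (if i < r - s then nat_of_ord i else i + (n.+1 - r)).
have gE i : g i = (if i < r - s then nat_of_ord i else i + (n.+1 - r)) :> nat.
  by rewrite inordK //; have := ltn_ord i; case: ifP; lia.
have rka : rk alpha = r.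
  apply: (@rk_eq _ _ _ g) => [i j /(congr1 val)|i|x].
  - rewrite /= !gE => E; apply: val_inj => /=.
    by have := ltn_ord i; have := ltn_ord j; move: E; do 2!case: ifP; lia.
  - exists (inord (if i < r - s then i + s else i - (r - s))).
    apply: val_inj; rewrite /= alphaE gE /f.
    have ir := ltn_ord i.
    by case: (ltnP i (r - s)) => irs; rewrite inordK; try case: ifP; lia.
  - have xn := ltn_ord x.
    have lt : (if x < s then r - s + x else minn (x - s) (r - s - 1)) < r.
      by case: ifP; lia.
    exists (Ordinal lt); apply: val_inj; rewrite /= alphaE gE /f /=.
    by case: (ltnP x s) => xs; case: ifP; lia.
rewrite -rka; apply: ell_rank_ge; rewrite ?rka //.
  exact: path_tournament_Tour.
move=> w we.
pose E : finType := ('I_s * 'I_(n.+1 - s) + 'I_(n.+1 - s))%type.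
pose x (e : E) : 'I_n.+1 :=
  match e with inl (i, j) => inord i | inr i => inord (i + s) end.
pose P (e : E) : pred 'I_n.+1 :=
  match e with inl (i, j) => [pred a : 'I_n.+1 | a <= i + j]
             | inr i => pred1 (inord (i + s)) end.
have lowE (i : 'I_s) : (inord i : 'I_n.+1) = i :> nat.
  by rewrite inordK //; have := ltn_ord i; lia.
have highE (i : 'I_(n.+1 - s)) : (inord (i + s) : 'I_n.+1) = i + s :> nat.
  by rewrite inordK //; have := ltn_ord i; lia.
have alphal (i : 'I_s) : alpha (inord i) = i + (n.+1 - s) :> nat.
  by rewrite alphaE lowE /f ltn_ord.
have alphah (i : 'I_(n.+1 - s)) :
    alpha (inord (i + s)) = minn i (r - s - 1) :> nat.
  by rewrite alphaE highE /f ltnNge leq_addl /= addnK.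
have -> : (s + 1) * (n.+1 - s) = #|E|.
  by rewrite card_sum card_prod !card_ord mulnDl mul1n.
apply: (departures_le_size (x := x) (P := P) we).
- case=> [[i j]|i] /=; last exact: eqxx.
  by rewrite lowE leq_addr.
- case=> [[i j]|i] /=.
    by rewrite alphal; have := ltn_ord j; lia.
  by rewrite -(inj_eq val_inj) /= alphah highE; lia.
- case=> [[i j]|i] [[i' j']|i'] a b ab /=.
  + rewrite -!ltnNge => Pa Pb Pa' Pb' /(congr1 val) /=; rewrite !alphal => ii.
    have ei : i = i' by apply: val_inj => /=; lia.
    subst i'; congr (inl (_, _)); apply: val_inj => /=.
    have := path_tournament_cross ab Pa Pb.
    by rewrite (path_tournament_cross ab Pa' Pb'); lia.
  + move=> _ _ _ _ /(congr1 val); rewrite /= alphal alphah.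
    by have := ltn_ord i'; lia.
  + move=> _ _ _ _ /(congr1 val); rewrite /= alphal alphah.
    by have := ltn_ord i; lia.
  + move=> /eqP -> _ /eqP/(congr1 val); rewrite /= !highE => ii _ _.
    by congr inr; apply: val_inj => /=; lia.
Qed.

(** For odd n this is the circulant tournament with arcs from a to a + d modulo
    n for d = 1, 3, ..., n - 2; parities avoid modular arithmetic. *)
Definition parity_tournament n : digraph n :=
  [set e : 'I_n * 'I_n | if e.1 < e.2 then odd (e.2 - e.1)
                         else (e.2 < e.1) && ~~ odd (e.1 - e.2)].

Lemma parity_tournamentE n (a b : 'I_n) : ((a, b) \in parity_tournament n) =
  if a < b then odd (b - a) else (b < a) && ~~ odd (a - b).
Proof. by rewrite inE. Qed.

Lemma parity_tournamentP n : tournament (parity_tournament n).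
Proof.
apply/andP; split; first by apply/forallP => u; rewrite parity_tournamentE ltnn.
apply/'forall_forallP => u v; apply/implyP; rewrite !parity_tournamentE.
rewrite -(inj_eq val_inj) /=.
by case: (ltngtP u v) => //= _ _; case: odd.
Qed.

(** If (b, a) is an arc, one of a + 1 and b - 1 is a midpoint from a to b.
    Neither is available only when b = 0 and a = n - 1, and then a - b is even
    because n is odd, so that (a, b) is an arc. *)
Lemma parity_tournament_distances n :
  odd n -> distances_le (parity_tournament n) 2.
Proof.
move=> oddn a b ab.
have [arcT|] := boolP ((a, b) \in parity_tournament n).
  by exists (fun i => if i is 0 then a else b), 1; do !split=> //; case.
move=> nab.
suff [c ac cb] : exists2 c, (a, c) \in parity_tournament n
                          & (c, b) \in parity_tournament n.
  exists (fun i => if i is j.+1 then (if j is 0 then c else b) else a), 2.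
  by do !split=> //; case=> [|[|]].
have an := ltn_ord a; have bn := ltn_ord b.
have nE : n.-1 = n./2.*2 by have := odd_double_half n; rewrite oddn; lia.
move: ab nab; rewrite -(inj_eq val_inj) /= parity_tournamentE.
case: (ltngtP a b) => //= [ltab|ltba] _ oddab.
  have cn : a.+1 < n by lia.
  exists (Ordinal cn); rewrite parity_tournamentE /=; last by case: ifP; lia.
  by rewrite ltnS leqnn; lia.
have [b0|b0] := posnP b.
  have cn : a.+1 < n by lia.
  exists (Ordinal cn); rewrite parity_tournamentE /=; [case: ifP; lia|].
  by rewrite ifN; lia.
have cn : b.-1 < n by lia.
exists (Ordinal cn); rewrite parity_tournamentE /=; last by case: ifP; lia.
by rewrite ifN; lia.
Qed.

(** * The bounds *)

Theorem theorem3p11 (n r : nat) (hodd : odd n) (hn : 3 <= n)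
    (hr2 : 2 <= r) (hrn : r <= n - 1) :
  let rhat := minn (r - 1) (n %/ 2) in
  (n + r - 2 <= ell_min_Tour n r <= n + 8 * r) /\
  ((rhat + 1) * (n - rhat) - 1 <= ell_max_Tour n r <= 6 * r * n + n - 10 * r).
Proof.
move=> rhat; have rn : r < n by lia.
rewrite /ell_min_Tour; split; apply/andP; split.
- have /nat_minP[[T TT <-] _] :
      exists k, exists2 T, T \in Tour n & ell_rank T r = k.
    by exists (ell_rank (path_tournament n) r), (path_tournament n);
      [exact: path_tournament_Tour|].
  by apply: leq_trans (ell_rank_ge_backward TT _); lia.
- pose T := parity_tournament n.
  have distT := parity_tournament_distances hodd.
  have TT : T \in Tour n.
    by rewrite inE parity_tournamentP (distances_le_strong distT).
  set Q := fun k => _.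
  have QT : Q (ell_rank T r) by exists T.
  have /nat_minP[_ /(_ _ QT)] : exists k, Q k by exists (ell_rank T r).
  move/leq_trans; apply.
  apply: leq_trans (ell_rank_le (parity_tournamentP n) distT _ rn) _; lia.
- apply: leq_trans (leq_bigmax_cond _ (path_tournament_Tour hn)).
  apply: leq_trans (leq_subr _ _) _; apply: ell_rank_path => //.
  by rewrite /rhat; lia.
- apply/bigmax_leqP => T; rewrite inE => /andP[tourT strT].
  have := ell_rank_le tourT (strong_distances_le tourT strT) _ rn.
  move=> /(_ ltac:(lia)) /leq_trans; apply.
  have [m nE] : exists m, n = m.+3 by exists (n - 3); lia.
  by subst n; nia.
Qed.
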